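(* For every integer $k\ge4$, put $$h_k=\operatorname{CH}(k-1,k-1)=f(2,k),\qquad c_k=\max\{\operatorname{CH}(k-1,k-2),\,3(k-1)\}.$$ Then $$f(3,k)\ \le\ \frac{k-1}{2}\bigl(c_k+3h_k-1\bigr).$$
   Context: All set families are finite families of distinct sets, and all graphs are finite and simple. A family is $w$-uniform if all its members have exactly $w$ elements (the ground set is an arbitrary finite set, not fixed). A $k$-sunflower is a collection of $k$ distinct sets $A_1,\dots,A_k$ for which there is a set $C$ (the core, possibly empty) with $A_i\cap A_j=C$ for all $i\ne j$. $f(w,k)$ denotes the maximum size of a $w$-uniform family containing no $k$-sunflower. For integers $D,q\ge1$, $\operatorname{CH}(D,q)$ is the maximum number of edges in a graph with maximum degree at most $D$ and matching number at most $q$; by the Chvátal–Hanson theorem (a known result), $$\operatorname{CH}(D,q)=Dq+\left\lfloor\tfrac D2\right\rfloor\left\lfloor\frac{q}{\lceil D/2\rceil}\right\rfloor .$$ *)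

(* Defs.v *)
From mathcomp Require Import all_boot.
From mathcomp Require Import boolp.
From mathcomp Require classical_sets.
Set Implicit Arguments.
Unset Strict Implicit.
Unset Printing Implicit Defensive.

Definition is_maximum (P : nat -> Prop) (m : nat) : Prop :=
  P m /\ forall n, P n -> n <= m.

(* Junk value 0 when P has no maximum; [f_maximum] and [CH_maximum] below show
   that this never happens for [f w k] with 0 < k, nor for [CH D q]. *)
Definition maximum (P : nat -> Prop) : nat := classical_sets.xget 0 (is_maximum P).

Section Families.
Variable T : finType.
Implicit Types (F S : {set {set T}}) (w k : nat).

Definition uniform w F : Prop := forall A, A \in F -> #|A| = w.

Definition sunflower k S : Prop :=
  #|S| = k /\
  exists C : {set T}, forall A B, A \in S -> B \in S -> A != B -> A :&: B = C.

Definition sunflower_free k F : Prop :=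
  forall S, S \subset F -> ~ sunflower k S.

End Families.

Definition f (w k : nat) : nat :=
  maximum (fun m => exists (T : finType) (F : {set {set T}}),
    [/\ uniform w F, sunflower_free k F & #|F| = m]).

Section Graphs.
Variable T : finType.
Implicit Types (e : rel T) (M : {set {set T}}).

Definition simple_graph e : Prop := symmetric e /\ irreflexive e.

Definition edges e : {set {set T}} :=
  [set [set p.1; p.2] | p : T * T & e p.1 p.2].

Definition degree e (x : T) : nat := #|[set y | e x y]|.

Definition max_degree e : nat := \max_(x : T) degree e x.

Definition matching e M : bool := (M \subset edges e) && trivIset M.

Definition matching_number e : nat :=
  \max_(M : {set {set T}} | matching e M) #|M|.

End Graphs.

Definition CH (D q : nat) : nat :=
  maximum (fun m => exists (T : finType) (e : rel T),
    [/\ simple_graph e, max_degree e <= D, matching_number e <= q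
      & #|edges e| = m]).

Lemma maximumP (P : nat -> Prop) (b : nat) :
  (exists m, P m) -> (forall m, P m -> m <= b) -> is_maximum P (maximum P).
Proof.
move=> [m0 Pm0] Pb; rewrite /maximum.
have exP : exists m, `[< P m >] by exists m0; apply/asboolP.
have ubP m : `[< P m >] -> m <= b by move/asboolP; exact: Pb.
case: (ex_maxnP exP ubP) => m /asboolP Pm mmax.
apply: (@classical_sets.xgetPex _ 0 (is_maximum P)); exists m; split=> // n Pn.
by apply: mmax; apply/asboolP.
Qed.

Lemma card_family_le (T : finType) (F : {set {set T}}) (w q d : nat) :
  uniform w.+1 F ->
  (forall S : {set {set T}}, S \subset F -> trivIset S -> #|S| <= q) ->
  (forall x, #|[set A in F | x \in A]| <= d) ->
  #|F| <= q * w.+1 * d.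
Proof.
move=> Fw Fq Fd.
pose P := [pred S : {set {set T}} | (S \subset F) && trivIset S].
have P0 : P set0 by rewrite /= sub0set; apply/trivIsetP=> A B; rewrite inE.
have [S /maxsetP[/andP[SF tS] Smax] _] := maxset_exists P0.
have FS : F \subset \bigcup_(x in cover S) [set A in F | x \in A].
  apply/subsetP=> A AF.
  suff [x xA xS] : exists2 x, x \in A & x \in cover S.
    by apply/bigcupP; exists x => //; rewrite inE AF.
  have [AS|AS] := boolP (A \in S).
    have /card_gt0P[x xA] : 0 < #|A| by rewrite (Fw _ AF).
    by exists x => //; apply/bigcupP; exists A.
  have [dA|] := boolP [disjoint A & cover S].
    suff E : A |: S = S by move: AS; rewrite -E setU11.
    apply: Smax; last exact: subsetUr.
    rewrite /= subUset sub1set AF SF /=.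
    have dAB B : B \in S -> [disjoint A & B].
      by move=> BS; apply: disjointWr dA; exact: bigcup_sup.
    apply/trivIsetP=> B C; rewrite !inE => /orP[/eqP->|BS] /orP[/eqP->|CS].
    - by rewrite eqxx.
    - by move=> _; exact: dAB.
    - by rewrite disjoint_sym => _; exact: dAB.
    - exact: (trivIsetP tS).
  by rewrite -setI_eq0 => /set0Pn[x]; rewrite inE => /andP[]; exists x.
have cS : #|cover S| <= q * w.+1.
  have /eqP <- := tS; rewrite (eq_bigr (fun=> w.+1)).
    by rewrite sum_nat_const leq_mul2r Fq ?orbT.
  by move=> A AS; apply: Fw; exact: (subsetP SF).
apply: leq_trans (subset_leq_card FS) _.
apply: (@leq_trans (\sum_(x in cover S) d)); last first.
  by rewrite sum_nat_const leq_mul2r cS orbT.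
elim/big_rec2: _ => [|x n B _ IH]; first by rewrite cards0.
by apply: leq_trans (leq_card_setU _ _) _; rewrite leq_add.
Qed.

Lemma subset_of_card (T : finType) (S : {set T}) (k : nat) :
  k <= #|S| -> exists2 S' : {set T}, S' \subset S & #|S'| = k.
Proof.
move=> kS; have : 0 < #|[set A : {set T} | A \subset S & #|A| == k]|.
  by rewrite cards_draws bin_gt0.
by case/card_gt0P=> A; rewrite inE => /andP[AS /eqP]; exists A.
Qed.

(* The Erdos-Rado sunflower lemma. *)
Lemma sunflower_free_card (T : finType) (w k : nat) (F : {set {set T}}) :
  uniform w F -> sunflower_free k.+1 F -> #|F| <= w`! * k ^ w.
Proof.
elim: w F => [|w IH] F Fw Fk.
  apply: (@leq_trans #|[set set0 : {set T}]|); last by rewrite cards1.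
  apply: subset_leq_card.
  by apply/subsetP=> A /Fw/eqP; rewrite cards_eq0 inE.
have -> : w.+1`! * k ^ w.+1 = k * w.+1 * (w`! * k ^ w).
  by rewrite factS expnS mulnACA [w.+1 * k]mulnC.
apply: card_family_le => // [S SF tS|x].
  rewrite leqNgt; apply/negP=> /subset_of_card[S' S'S cS'].
  apply: (Fk S' (subset_trans S'S SF)); split=> //; exists set0 => A B AS BS AB.
  apply/eqP; rewrite setI_eq0.
  by apply: (trivIsetP tS) => //; exact: (subsetP S'S).
set G := [set A in F | x \in A].
have injx : {in G &, injective (fun A => A :\ x)}.
  move=> A B; rewrite !inE => /andP[_ xA] /andP[_ xB] E.
  by rewrite -(setD1K xA) -(setD1K xB) E.
rewrite -(card_in_imset injx); apply: IH.
  move=> B /imsetP[A]; rewrite inE => /andP[AF xA] ->.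
  by apply/eqP; rewrite -eqSS -(Fw _ AF) (cardsD1 x A) xA.
move=> S SG [cS [C SC]].
have SN A : A \in S -> x \notin A /\ x |: A \in F.
  move=> /(subsetP SG)/imsetP[B]; rewrite inE => /andP[BF xB] ->.
  by rewrite setD11 setD1K.
have injU : {in S &, injective (fun A => x |: A)}.
  move=> A B /SN[xA _] /SN[xB _] E.
  by rewrite -(setU1K xA) -(setU1K xB) E.
apply: (Fk [set x |: A | A in S]).
  by apply/subsetP=> _ /imsetP[A /SN[_ AF] ->].
split; first by rewrite card_in_imset.
exists (x |: C) => _ _ /imsetP[A AS ->] /imsetP[B BS ->] AB.
rewrite -setUIr; congr (_ |: _); apply: SC => //.
by apply: contra AB => /eqP->.
Qed.

Lemma f_maximum (w k : nat) : 0 < k ->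
  is_maximum (fun m => exists (T : finType) (F : {set {set T}}),
    [/\ uniform w F, sunflower_free k F & #|F| = m]) (f w k).
Proof.
case: k => // k _; apply: (@maximumP _ (w`! * k ^ w)).
  exists 0, void, set0; split; last exact: cards0.
  - by move=> A; rewrite inE.
  - by move=> S; rewrite subset0 => /eqP-> []; rewrite cards0.
by move=> m [T [F [Fw Fk <-]]]; exact: sunflower_free_card.
Qed.

Lemma edges_uniform (T : finType) (e : rel T) :
  simple_graph e -> uniform 2 (edges e).
Proof.
move=> [_ ei] _ /imsetP[[x y] /= exy ->]; rewrite cards2.
by case: eqP exy => // ->; rewrite inE /= ei.
Qed.

Lemma CH_maximum (D q : nat) :
  is_maximum (fun m => exists (T : finType) (e : rel T),
    [/\ simple_graph e, max_degree e <= D, matching_number e <= q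
      & #|edges e| = m]) (CH D q).
Proof.
apply: (@maximumP _ (q * 2 * D)).
  exists 0, void, (fun _ _ => false).
  have E0 : edges (fun _ _ : void => false) = set0.
    by apply/setP=> A; rewrite inE; apply/imsetP=> -[[]].
  split=> //; last by rewrite E0 cards0.
  - by apply/bigmax_leqP=> -[].
  - by apply/bigmax_leqP=> M /andP[]; rewrite E0 subset0 => /eqP->; rewrite cards0.
move=> m [T [e [ge eD eq <-]]].
apply: card_family_le; first exact: edges_uniform.
  move=> S SE tS; apply: leq_trans eq.
  by apply: (leq_bigmax_cond (P := matching e)); rewrite /matching SE tS.
move=> x; apply: leq_trans eD; apply: leq_trans (leq_bigmax x).
apply: leq_trans (leq_imset_card (fun y => [set x; y]) _).
apply: subset_leq_card; apply/subsetP=> A; rewrite inE => /andP[].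
case/imsetP=> [[y z]] /=; rewrite inE /= => eyz ->.
rewrite !inE => /orP[]/eqP->; apply/imsetP.
  by exists z; rewrite ?inE.
by exists y; rewrite ?inE ?(ge.1 z) // setUC.
Qed.

(* Main.v *)
(** Fix a family [F] without (D+1)-sunflower, D = k - 1, and a matching [M] of
    maximum size in [F], with vertex set [V].  Every member of [F] meets [V], so
    2|F| + |M| is at most the sum over [V] of the degrees in [F] plus the number
    of members meeting [V] in a single point.  The link of a point is a
    sunflower-free graph, hence has at most h = CH D D edges.  For a block [A] of
    [M], the members meeting [V] in exactly one point of [A] give three graphs
    outside [V], one for each point of [A].  They pairwise cross-intersect, for
    otherwise [A] could be exchanged for two disjoint triples.  If at least two of
    them are nonempty, they have at most 3D edges in total; a single nonempty one
    has no matching of size D, since together with the pair left in [A] this would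
    be a sunflower, so it has at most CH D (D-1) edges. *)
Require Import Defs.
From mathcomp Require Import all_boot all_order all_algebra.
From mathcomp Require Import zify lra.
Local Open Scope ring_scope.

Section Families.
Set Implicit Arguments.
Unset Strict Implicit.
Local Open Scope nat_scope.
Variable T : finType.
Implicit Types (F G H S M : {set {set T}}) (A B C E e g : {set T}) (D k q w : nat).

(** * Links, and graphs without sunflowers *)

Definition link (x : T) F : {set {set T}} := [set A :\ x | A in F & x \in A].

Definition cross_intersecting G H : Prop :=
  forall g e, g \in G -> e \in H -> ~~ [disjoint g & e].

Lemma linkP x F A : reflect (x \notin A /\ x |: A \in F) (A \in link x F).
Proof.
apply: (iffP imsetP) => [[B]|[xA AF]].
  by rewrite inE => /andP[BF xB] ->; rewrite setD11 setD1K.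
by exists (x |: A); rewrite ?inE ?AF ?eqxx // setU1K.
Qed.

Lemma card_link x F : #|link x F| = #|[set A in F | x \in A]|.
Proof.
rewrite /link card_in_imset // => A B.
by rewrite !inE => /andP[_ xA] /andP[_ xB] E; rewrite -(setD1K xA) -(setD1K xB) E.
Qed.

Lemma link_uniform x w F : uniform w.+1 F -> uniform w (link x F).
Proof.
by move=> Fw A /linkP[xA /Fw]; rewrite cardsU1 xA => -[].
Qed.

Lemma link_sunflower_free x k F : sunflower_free k F -> sunflower_free k (link x F).
Proof.
move=> Fk S SF [cS [C SC]].
have SN A : A \in S -> x \notin A /\ x |: A \in F by move=> /(subsetP SF)/linkP.
have injU : {in S &, injective (fun A => x |: A)}.
  by move=> A B /SN[xA _] /SN[xB _] E; rewrite -(setU1K xA) -(setU1K xB) E.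
apply: (Fk [set x |: A | A in S]).
  by apply/subsetP=> _ /imsetP[A /SN[_ AF] ->].
split; first by rewrite card_in_imset.
exists (x |: C) => _ _ /imsetP[A AS ->] /imsetP[B BS ->] AB.
rewrite -setUIr; congr (_ |: _); apply: SC => //.
by apply: contra AB => /eqP->.
Qed.

Lemma sunflower_free_trivIset k F S :
  sunflower_free k.+1 F -> S \subset F -> trivIset S -> #|S| <= k.
Proof.
move=> Fk SF tS; rewrite leqNgt; apply/negP=> /subset_of_card[S' S'S cS'].
apply: (Fk S' (subset_trans S'S SF)); split=> //; exists set0 => A B AS BS AB.
apply/eqP; rewrite setI_eq0.
by apply: (trivIsetP tS) => //; exact: (subsetP S'S).
Qed.

(** The link of a vertex in a graph consists of singletons, which are pairwise disjoint, so a large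
    star would already be a sunflower. *)
Lemma sunflower_free_degree k F x :
  uniform 2 F -> sunflower_free k.+1 F -> #|[set A in F | x \in A]| <= k.
Proof.
move=> F2 Fk; rewrite -card_link.
apply: (sunflower_free_trivIset (link_sunflower_free (x := x) Fk)) => //.
have L1 A : A \in link x F -> exists y, A = [set y].
  by move/(link_uniform (w := 1) F2)/eqP/cards1P.
apply/trivIsetP=> _ _ /L1[y ->] /L1[z ->] yz.
by rewrite disjoints1 inE; apply: contra yz => /eqP->.
Qed.

(** A sunflower of pairs with empty core is a matching; with a core point [x] it lies in the star at
    [x]. Either way it has at most [k] petals. *)
Lemma sunflower_free_graph k F : 0 < k -> uniform 2 F ->
  (forall x, #|[set A in F | x \in A]| <= k) ->
  (forall S, S \subset F -> trivIset S -> #|S| <= k) ->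
  sunflower_free k.+1 F.
Proof.
move=> k0 F2 Fd Fq S SF [cS [C SC]].
have [C0|[x xC]] := set_0Vmem C.
  suff /(Fq _ SF) : trivIset S by rewrite cS ltnn.
  by apply/trivIsetP=> A B AS BS AB; rewrite -setI_eq0 (SC A B) // C0.
have : #|S| <= #|[set A in F | x \in A]|.
  apply/subset_leq_card/subsetP=> A AS; rewrite inE (subsetP SF) //=.
  (* As [0 < k], there is a second petal [B]; its intersection with [A] is the core, which puts [x]
     in [A]. *)
  have /card_gt0P[B] : 0 < #|S :\ A|.
    by move: cS; rewrite (cardsD1 A) AS add1n => -[->].
  rewrite !inE => /andP[BA BS]; move: xC.
  by rewrite -(SC A B) // 1?eq_sym // inE => /andP[].
by rewrite cS => /leq_trans/(_ (Fd x)); rewrite ltnn.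
Qed.

(** Transfers the extremal number from adjacency relations to families of pairs, the form in which
    links arise. *)
Lemma edges_card_le_CH D q F : uniform 2 F ->
  (forall x, #|[set A in F | x \in A]| <= D) ->
  (forall S, S \subset F -> trivIset S -> #|S| <= q) ->
  #|F| <= CH D q.
Proof.
move=> F2 FD Fq; have [_] := CH_maximum D q; apply.
pose e x y := (x != y) && ([set x; y] \in F).
have eF : edges e = F.
  apply/setP=> A; apply/imsetP/idP => [[[x y]]|AF].
    by rewrite inE /= => /andP[_ xyF] ->.
  have /eqP/cards2P[x [y [xy EA]]] := F2 _ AF.
  by exists (x, y) => //; rewrite inE /= /e xy -EA.
exists T, e; split; last by rewrite eF.
- split=> [x y|x]; first by rewrite /e eq_sym setUC.
  by rewrite /e eqxx.
- apply/bigmax_leqP=> x _; apply: leq_trans (FD x).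
  rewrite /degree -(card_in_imset (f := fun y => [set x; y])) => [|y z].
    apply/subset_leq_card/subsetP=> A /imsetP[y]; rewrite inE => /andP[_ yF] ->.
    by rewrite inE yF !inE eqxx.
  rewrite !inE => /andP[xy _] /andP[xz _] /setP/(_ y).
  by rewrite !inE eqxx orbT [y == x]eq_sym (negPf xy) => /esym/eqP.
- by apply/bigmax_leqP=> M /andP[]; rewrite eF; exact: Fq.
Qed.

(** * Cross-intersecting graphs *)

Lemma card_star_le G x D (G' : {set {set T}}) :
  (forall x, #|[set A in G | x \in A]| <= D) ->
  (forall g, g \in G -> (x \in g) || (g \in G')) -> #|G| <= D + #|G'|.
Proof.
move=> GD Gx; apply: leq_trans (leq_add (GD x) (leqnn _)).
apply: leq_trans (leq_card_setU _ _); apply/subset_leq_card/subsetP=> g gG.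
by rewrite !inE gG Gx.
Qed.

Lemma cards_pairP g x y : #|g| = 2 -> x \in g -> y \in g -> x != y -> g = [set x; y].
Proof.
move=> g2 xg yg xy; apply/esym/eqP; rewrite eqEcard g2 cards2 xy.
by rewrite subUset !sub1set xg yg.
Qed.

(** A single edge of [H] is met by all of [G], so the stars at its two ends cover [G]. *)
Lemma cross_card1 D G H :
  uniform 2 H -> (forall x, #|[set A in G | x \in A]| <= D) ->
  cross_intersecting G H -> 0 < #|H| -> #|G| <= 2 * D.
Proof.
move=> H2 GD GH /card_gt0P[e eH]; have /eqP/cards2P[x [y [_ Ee]]] := H2 _ eH.
rewrite mul2n -addnn.
apply: leq_trans (card_star_le (x := x) (G' := [set A in G | y \in A]) GD _) _.
  move=> g gG; have := GH _ _ gG eH; rewrite -setI_eq0 => /set0Pn[z].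
  by rewrite Ee !inE gG => /andP[zg /orP[]/eqP <-]; rewrite zg ?orbT.
by rewrite leq_add2l.
Qed.

(** An edge of [G] must take one end from each of the two disjoint edges, which leaves four
    transversals. *)
Lemma cross_disjoint G H a b c d : uniform 2 G -> cross_intersecting G H ->
  [set a; b] \in H -> [set c; d] \in H -> [disjoint [set a; b] & [set c; d]] ->
  G \subset [set [set a; c]; [set a; d]; [set b; c]; [set b; d]].
Proof.
move=> G2 GH abH cdH dis; apply/subsetP=> g gG.
have := GH _ _ gG abH; rewrite -setI_eq0 => /set0Pn[x] /setIP[xg xab].
have := GH _ _ gG cdH; rewrite -setI_eq0 => /set0Pn[y] /setIP[yg ycd].
have xy : x != y.
  by apply: contraTneq ycd => <-; rewrite (disjointFr dis).
rewrite (cards_pairP (G2 _ gG) xg yg xy).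
by case/set2P: xab => ->; case/set2P: ycd => ->; rewrite !inE eqxx ?orbT.
Qed.

(** An edge of [G] that avoids the common end [u] has to contain both other ends. *)
Lemma cross_share G H u x y : uniform 2 G -> cross_intersecting G H -> x != y ->
  [set u; x] \in H -> [set u; y] \in H ->
  forall g, g \in G -> (u \in g) || (g == [set x; y]).
Proof.
move=> G2 GH xy uxH uyH g gG; have [//|ug /=] := boolP (u \in g).
have H1 z : [set u; z] \in H -> z \in g.
  move=> uzH; have := GH _ _ gG uzH; rewrite -setI_eq0 => /set0Pn[t].
  by rewrite !inE => /andP[tg /orP[]/eqP E]; move: tg; rewrite E // (negPf ug).
by rewrite (cards_pairP (G2 _ gG) (H1 _ uxH) (H1 _ uyH) xy).
Qed.

Lemma pairs_meet e g : #|e| = 2 -> #|g| = 2 -> e != g -> ~~ [disjoint e & g] ->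
  exists u x y, [/\ e = [set u; x], g = [set u; y], u != x, u != y & x != y].
Proof.
move=> e2 g2 eg; rewrite -setI_eq0 => /set0Pn[u] /setIP[ue ug].
have R A : #|A| = 2 -> u \in A -> exists2 x, A = [set u; x] & u != x.
  move=> A2 uA; have /cards1P[x Ex] : #|A :\ u| == 1.
    by move: A2; rewrite (cardsD1 u) uA add1n => -[->].
  exists x; first by rewrite -(setD1K uA) Ex.
  by have := set11 x; rewrite -Ex !inE eq_sym => /andP[].
have [x Ee ux] := R _ e2 ue; have [y Eg uy] := R _ g2 ug.
exists u, x, y; split=> //; apply: contraNneq eg => xy.
by rewrite Ee Eg xy.
Qed.

Lemma cards3_le A B C : #|[set A; B; C]| <= 3.
Proof.
apply: leq_trans (leq_card_setU _ _) _; rewrite cards1 cards2.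
by case: (_ != _).
Qed.

Lemma cards4_le A B C E : #|[set A; B; C; E]| <= 4.
Proof.
by apply: leq_trans (leq_card_setU _ _) _; rewrite cards1 addn1 ltnS cards3_le.
Qed.

(** Two disjoint edges of [H] allow four transversals, and [2 < D] gives room for them; two edges
    sharing [u] allow the star at [u] and one more pair. *)
Lemma cross_card2 D G H : 2 < D -> uniform 2 G -> uniform 2 H ->
  (forall x, #|[set A in G | x \in A]| <= D) ->
  cross_intersecting G H -> 1 < #|H| -> #|G| <= D.+1.
Proof.
move=> D3 G2 H2 GD GH /card_gt1P[e1 [e2 [e1H e2H e12]]].
have [dis|meet] := boolP [disjoint e1 & e2].
  have /eqP/cards2P[a [b [_ E1]]] := H2 _ e1H.
  have /eqP/cards2P[c [d [_ E2]]] := H2 _ e2H; subst.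
  have /subset_leq_card := cross_disjoint G2 GH e1H e2H dis.
  by move=> /leq_trans/(_ (cards4_le _ _ _ _))/leq_trans; apply.
have [u [x [y [E1 E2 _ _ xy]]]] := pairs_meet (H2 _ e1H) (H2 _ e2H) e12 meet.
subst; rewrite -addn1 -(cards1 [set x; y]); apply: (card_star_le (x := u)) => // g gG.
by rewrite inE; exact: (cross_share G2 GH xy e1H e2H gG).
Qed.

(** Being distinct from both, [e3] misses an end [a] of [e1] and an end [c] of [e2]; this rules out
    the transversal [[set a; c]]. *)
Lemma cross_disjoint3 G H e1 e2 e3 : uniform 2 G -> uniform 2 H ->
  cross_intersecting G H -> e1 \in H -> e2 \in H -> e3 \in H ->
  [disjoint e1 & e2] -> e3 != e1 -> e3 != e2 -> #|G| <= 3.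
Proof.
move=> G2 H2 GH e1H e2H e3H dis e31 e32.
have R e : e \in H -> e3 != e -> exists a b, e = [set a; b] /\ a \notin e3.
  move=> eH e3e; have /eqP/cards2P[a [b [ab Ee]]] := H2 _ eH.
  have [ae3|ae3] := boolP (a \in e3); last by exists a, b.
  have [be3|be3] := boolP (b \in e3); last by exists b, a; rewrite setUC.
  by rewrite Ee (cards_pairP (H2 _ e3H) ae3 be3 ab) eqxx in e3e.
have [a [b [E1 ae3]]] := R _ e1H e31; have [c [d [E2 ce3]]] := R _ e2H e32; subst.
have acG : [set a; c] \notin G.
  apply/negP=> acG; have := GH _ _ acG e3H.
  by rewrite -setI_eq0 => /set0Pn[z] /setIP[/set2P[]-> zz]; rewrite zz in ae3 ce3.
apply: leq_trans (cards3_le [set a; d] [set b; c] [set b; d]).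
apply/subset_leq_card/subsetP=> g gG.
have := subsetP (cross_disjoint G2 GH e1H e2H dis) _ gG; rewrite !inE.
by case: (eqVneq g [set a; c]) => [Eg|_ //]; rewrite -Eg gG in acG.
Qed.

(** If [e1] and [e2] meet at [u], then [G] is a star at [u] unless it contains the pair closing the
    triangle. In that case [e3] either is disjoint from [e1] or [e2], or is the closing pair
    itself. *)
Lemma cross_card3 D G H : 2 < D -> uniform 2 G -> uniform 2 H ->
  (forall x, #|[set A in G | x \in A]| <= D) ->
  cross_intersecting G H -> 2 < #|H| -> #|G| <= D.
Proof.
move=> D3 G2 H2 GD GH /card_gt2P[e1 [e2 [e3 [[e1H e2H e3H] [e12 e23 e31]]]]].
have [dis|meet] := boolP [disjoint e1 & e2].
  by apply: leq_trans D3; apply: (cross_disjoint3 G2 H2 GH e1H e2H e3H); rewrite // eq_sym.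
have [u [x [y [E1 E2 ux uy xy]]]] := pairs_meet (H2 _ e1H) (H2 _ e2H) e12 meet.
subst; have Gu := cross_share G2 GH xy e1H e2H.
have [xyG|xyG] := boolP ([set x; y] \in G); last first.
  rewrite -[D]addn0 -(cards0 {set T}); apply: (card_star_le (x := u)) => // g gG.
  case/orP: (Gu _ gG) => [->//|/eqP Eg]; by rewrite -Eg gG in xyG.
(* Since [e3] meets [[set x; y]], containing [u] would make it equal to [e1] or [e2]. *)
have ue3 : u \notin e3.
  apply/negP=> ue3; have := GH _ _ xyG e3H; rewrite -setI_eq0 => /set0Pn[t].
  case/setIP=> /set2P[]-> te3.
    by rewrite (cards_pairP (H2 _ e3H) ue3 te3 ux) eqxx in e31.
  by rewrite (cards_pairP (H2 _ e3H) ue3 te3 uy) eqxx in e23.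
have dis3 z : z \notin e3 -> [disjoint [set u; z] & e3].
  move=> ze3; apply/pred0P=> t; rewrite !inE /=.
  by apply/negP=> /andP[/orP[]/eqP-> te3]; move: te3; apply/negP.
have [xe3|xe3] := boolP (x \in e3); last first.
  apply: leq_trans D3; apply: (cross_disjoint3 G2 H2 GH e1H e3H e2H (dis3 _ xe3)) => //.
  by rewrite eq_sym.
have [ye3|ye3] := boolP (y \in e3); last first.
  apply: leq_trans D3; apply: (cross_disjoint3 G2 H2 GH e2H e3H e1H (dis3 _ ye3)) => //.
  by rewrite eq_sym.
(* The three edges now form a triangle, and a pair meeting all its sides is one of the sides. *)
have E3 := cards_pairP (H2 _ e3H) xe3 ye3 xy; subst.
apply: leq_trans D3; apply: leq_trans (cards3_le [set u; x] [set u; y] [set x; y]).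
apply/subset_leq_card/subsetP=> g gG; rewrite !inE.
case/orP: (Gu _ gG) => [ug|->]; last by rewrite orbT.
have := GH _ _ gG e3H; rewrite -setI_eq0 => /set0Pn[t].
case/setIP=> tg /set2P[] Et; subst t.
  by rewrite (cards_pairP (G2 _ gG) ug tg ux) eqxx.
by rewrite (cards_pairP (G2 _ gG) ug tg uy) eqxx orbT.
Qed.

Lemma cross_triple D q G1 G2 G3 : 2 < D ->
  (forall G, G \in [:: G1; G2; G3] -> uniform 2 G) ->
  (forall G, G \in [:: G1; G2; G3] -> forall x, #|[set A in G | x \in A]| <= D) ->
  (forall G, G \in [:: G1; G2; G3] -> #|G| <= q) ->
  cross_intersecting G1 G2 -> cross_intersecting G1 G3 -> cross_intersecting G2 G3 ->
  #|G1| + #|G2| + #|G3| <= maxn q (3 * D).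
Proof.
move=> D3 GU GD Gq C12 C13 C23.
have sym G H : cross_intersecting G H -> cross_intersecting H G.
  by move=> C h g hH gG; rewrite disjoint_sym; exact: C.
have bound G H : G \in [:: G1; G2; G3] -> H \in [:: G1; G2; G3] ->
    cross_intersecting G H ->
    [/\ 0 < #|H| -> #|G| <= 2 * D, 1 < #|H| -> #|G| <= D.+1 & 2 < #|H| -> #|G| <= D].
  move=> /[dup]/GU UG /GD DG /GU UH C; split.
  - exact: cross_card1.
  - exact: cross_card2.
  - exact: cross_card3.
(* A graph with more than [D] edges leaves at most two edges to each of the others. If both are
   empty, [q] bounds the sum; otherwise it is at most [2 * D + 2] or [D + 5], both at most
   [3 * D]. *)
have large G H K : G \in [:: G1; G2; G3] -> H \in [:: G1; G2; G3] ->
    K \in [:: G1; G2; G3] -> cross_intersecting G H -> cross_intersecting G K ->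
    D < #|G| -> #|G| + #|H| + #|K| <= maxn q (3 * D).
  move=> iG iH iK /(bound _ _ iG iH)[H1 H2 H3] /(bound _ _ iG iK)[K1 K2 K3] DG.
  have := Gq _ iG; move: H1 H2 H3 K1 K2 K3.
  by case: #|H| => [|[|[|h]]]; case: #|K| => [|[|[|l]]] H1 H2 H3 K1 K2 K3; lia.
have i1 : G1 \in [:: G1; G2; G3] by rewrite !inE eqxx.
have i2 : G2 \in [:: G1; G2; G3] by rewrite !inE eqxx orbT.
have i3 : G3 \in [:: G1; G2; G3] by rewrite !inE eqxx !orbT.
have [le1|/(large _ _ _ i1 i2 i3 C12 C13)//] := leqP #|G1| D.
have [le2|/(large _ _ _ i2 i1 i3 (sym _ _ C12) C23)] := leqP #|G2| D; last by lia.
have [le3|/(large _ _ _ i3 i1 i2 (sym _ _ C13) (sym _ _ C23))] := leqP #|G3| D; lia.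
Qed.

(** * Counting incidences with the cover of a matching *)

Definition tangent F (V : {set T}) (a : T) : {set {set T}} :=
  [set E in F | E :&: V == [set a]].

Lemma sum_card_setI F (V : {set T}) :
  \sum_(E in F) #|E :&: V| = \sum_(x in V) #|[set A in F | x \in A]|.
Proof.
transitivity (\sum_(E in F) \sum_(x in V) (x \in E : nat)).
  apply: eq_bigr => E _; rewrite -sum1_card -big_mkcondr /=.
  by apply: eq_bigl => x; rewrite inE andbC.
rewrite exchange_big /=; apply: eq_bigr => x _.
rewrite -sum1_card -big_mkcondr /=.
by apply: eq_bigl => A; rewrite inE.
Qed.

Lemma card_tangent F (V : {set T}) :
  \sum_(E in F) (#|E :&: V| == 1) = \sum_(x in V) #|tangent F V x|.
Proof.
transitivity (\sum_(E in F) \sum_(x in V) (E :&: V == [set x] : nat)); last first.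
  rewrite exchange_big /=; apply: eq_bigr => x _.
  rewrite -sum1_card -big_mkcondr /=.
  by apply: eq_bigl => A; rewrite inE.
apply: eq_bigr => E _; have [/cards1P[x Ex]|n1] := boolP (#|E :&: V| == 1).
  have xV : x \in V by have := set11 x; rewrite -Ex inE => /andP[].
  rewrite (bigD1 x) //= Ex eqxx big1 // => y /andP[_ yx].
  by rewrite (inj_eq set1_inj) eq_sym (negPf yx).
rewrite big1 // => x _; case: eqP => // Ex.
by rewrite Ex cards1 in n1.
Qed.

Lemma card_le_maximal_matching F M c h : uniform 3 F -> M \subset F -> trivIset M ->
  (forall E, E \in F -> ~~ [disjoint E & cover M]) ->
  (forall x, #|[set A in F | x \in A]| <= h) ->
  (forall A, A \in M -> \sum_(a in A) #|tangent F (cover M) a| <= c) ->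
  2 * #|F| + #|M| <= #|M| * (c + 3 * h).
Proof.
move=> F3 MF tM Mmax Fh Mc.
have cV : #|cover M| = #|M| * 3.
  rewrite -(eqP tM) (eq_bigr (fun=> 3)) ?sum_nat_const // => A AM.
  exact/F3/(subsetP MF).
apply: (@leq_trans (\sum_(E in F) ((#|E :&: cover M| == 1) + #|E :&: cover M|))).
  (* A block of [M] meets its cover in 3 points; this accounts for the -1 in the bound. *)
  have -> : 2 * #|F| + #|M| = \sum_(E in F) (2 + (E \in M)).
    rewrite big_split /= sum_nat_const mulnC; congr (_ + _).
    rewrite -sum1_card -big_mkcondr /=; apply: eq_bigl => E.
    by case: (boolP (E \in M)) => [/(subsetP MF)->|]; rewrite ?andbF.
  apply: leq_sum => E EF; have [EM|_] := boolP (E \in M).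
    have /setIidPl -> : E \subset cover M by apply: bigcup_sup EM.
    by rewrite F3.
  have := Mmax _ EF; rewrite -setI_eq0 -card_gt0.
  by case: #|_| => [|[|n]].
(* The tangents are summed block by block, at most [c] each; the degrees are summed over the
   [#|M| * 3] points of the cover. *)
rewrite big_split /= card_tangent sum_card_setI mulnDr leq_add //.
  by rewrite big_trivIset //= -sum_nat_const; exact: leq_sum.
by rewrite mulnA -cV -sum_nat_const; apply: leq_sum.
Qed.

(** * Augmentation and exchange in a maximum matching *)

Lemma trivIset_setU1 M A : trivIset M -> [disjoint A & cover M] -> trivIset (A |: M).
Proof.
move=> tM dA; have dAB B : B \in M -> [disjoint A & B].
  by move=> BM; apply: disjointWr dA; exact: bigcup_sup.
apply/trivIsetP=> B C; rewrite !inE => /orP[/eqP->|BM] /orP[/eqP->|CM].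
- by rewrite eqxx.
- by move=> _; exact: dAB.
- by rewrite disjoint_sym => _; exact: dAB.
- exact: (trivIsetP tM).
Qed.

Lemma card_setU1_disjoint M A : A != set0 -> [disjoint A & cover M] ->
  #|A |: M| = #|M|.+1.
Proof.
move=> A0 dA; rewrite cardsU1; suff -> : A \notin M by [].
apply: contra A0 => AM; have := disjointWr (bigcup_sup A AM : A \subset cover M) dA.
by rewrite -setI_eq0 setIid.
Qed.

Lemma card_le_3uniform F D : 2 < D -> uniform 3 F -> sunflower_free D.+1 F ->
  2 * #|F| <= D * (maxn (CH D D.-1) (3 * D) + 3 * CH D D).-1.
Proof.
move=> D3 F3 FD; set c := maxn _ _; set h := CH D D.
have L2 x : uniform 2 (link x F) := link_uniform (w := 2) F3.
have LD x := link_sunflower_free (x := x) FD.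
have Ldeg x y : #|[set A in link x F | y \in A]| <= D by exact: sunflower_free_degree.
have Fh x : #|[set A in F | x \in A]| <= h.
  rewrite -card_link; apply: edges_card_le_CH => // S.
  exact: sunflower_free_trivIset.
pose P S := (S \subset F) && trivIset S.
have P0 : P set0 by rewrite /P sub0set; apply/trivIsetP=> A B; rewrite inE.
(* Maximality is by cardinality, not inclusion: the exchange below removes a block before adding
   two. *)
case: (@arg_maxnP _ set0 P (fun S => #|S|) P0) => M /andP[MF tM] Mmax.
have Mmeet E : E \in F -> ~~ [disjoint E & cover M].
  move=> EF; apply/negP=> dE; have := Mmax (E |: M).
  rewrite /P subUset sub1set EF MF trivIset_setU1 // => /(_ isT) /=.
  by rewrite card_setU1_disjoint //= ?ltnn // -card_gt0 F3.
have Mc A : A \in M -> \sum_(a in A) #|tangent F (cover M) a| <= c.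
  move=> AM; set V := cover M.
  have AF := subsetP MF _ AM; have AV : A \subset V by apply: bigcup_sup AM.
  pose G a := link a (tangent F V a).
  have tL a E : E \in tangent F V a -> a \in E.
    by rewrite inE => /andP[_ /eqP/setP/(_ a)]; rewrite !inE eqxx => /andP[].
  have GE a : #|tangent F V a| = #|G a|.
    rewrite card_link; congr #|pred_of_set _|; apply/setP=> E.
    by rewrite [RHS]inE; case: (boolP (E \in _)) => // /tL ->.
  have GL a : G a \subset link a F.
    by apply/subsetP=> E /linkP[aE]; rewrite inE => /andP[EF _]; apply/linkP.
  have GV a E : E \in G a -> [disjoint E & V].
    case/linkP=> aE; rewrite inE => /andP[_ /eqP/setP Ea].
    apply/pred0P=> x; apply/negP=> /= /andP[xE xV].
    by have := Ea x; rewrite !inE xE xV orbT => /esym/eqP Ex; rewrite -Ex xE in aE.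
  have Gdeg a x : #|[set E in G a | x \in E]| <= D.
    apply: leq_trans (Ldeg a x); apply/subset_leq_card/subsetP=> E.
    by rewrite !inE => /andP[/(subsetP (GL a)) -> ->].
  have G2 a : uniform 2 (G a) by move=> E /(subsetP (GL a))/L2.
  have Gq a : a \in A -> #|G a| <= CH D D.-1.
    move=> aA; apply: edges_card_le_CH => // S SG tS.
    (* The pair [A :\ a] lies in the link of [a] and, being inside [V], is disjoint from [S]. Adding
       it to [S] gives a matching of at most [D] pairs, whence [D.-1] for [S]. *)
    have dA : [disjoint A :\ a & cover S].
      rewrite disjoint_sym; apply: disjointWr (subset_trans (subsetDl _ _) AV) _.
      apply/pred0P=> x; apply/negP=> /= /andP[/bigcupP[E ES xE] xV].
      by have := disjointFr (GV _ _ (subsetP SG _ ES)) xE; rewrite xV.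
    rewrite -ltnS prednK; last exact: leq_trans D3.
    rewrite -(card_setU1_disjoint _ dA); last first.
      by rewrite -card_gt0 -ltnS; have := F3 _ AF; rewrite (cardsD1 a) aA add1n => ->.
    apply: (sunflower_free_trivIset (LD a)); last exact: trivIset_setU1.
    rewrite subUset sub1set (subset_trans SG (GL a)) andbT.
    by apply/linkP; rewrite setD11 setD1K.
  (* If [E1] and [E2] were disjoint, replacing [A] by [a |: E1] and [b |: E2] would enlarge [M]. *)
  have Gx a b : a \in A -> b \in A -> a != b -> cross_intersecting (G a) (G b).
    move=> aA bA ab E1 E2 E1a E2b; apply/negP=> d12.
    have d1V := GV _ _ E1a; have d2V := GV _ _ E2b.
    have [aV bV] := (subsetP AV _ aA, subsetP AV _ bA).
    case/linkP: E1a => aE1; rewrite inE => /andP[aE1F _].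
    case/linkP: E2b => bE2; rewrite inE => /andP[bE2F _].
    have tMA : trivIset (M :\ A) by apply: trivIsetS tM; exact: subsetDl.
    have WA x : x \in cover (M :\ A) -> x \in V /\ x \notin A.
      case/bigcupP=> B; rewrite !inE => /andP[BA BM] xB; split.
        by apply/bigcupP; exists B.
      by rewrite (disjointFr (trivIsetP tM _ _ BM AM BA)).
    have d2 : [disjoint b |: E2 & cover (M :\ A)].
      apply/pred0P=> x; apply/negP=> /= /andP[/setU1P[->|xE2] /WA[xV]].
        by rewrite bA.
      by rewrite (disjointFr d2V) in xV.
    have d1 : [disjoint a |: E1 & cover ((b |: E2) |: (M :\ A))].
      rewrite /cover bigcup_setU big_set1 -/(cover _).
      apply/pred0P=> x; apply/negP=> /= /andP[/setU1P[->|xE1]].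
        rewrite !inE (negPf ab) (disjointFl d2V aV) /= => /WA[_].
        by rewrite aA.
      case/setUP=> [/setU1P[xb|xE2]|/WA[]].
      - by rewrite -xb (disjointFr d1V xE1) in bV.
      - by rewrite (disjointFr d12 xE1) in xE2.
      - by rewrite (disjointFr d1V xE1).
    have := Mmax ((a |: E1) |: ((b |: E2) |: (M :\ A))).
    have U0 x (B : {set T}) : x |: B != set0 by apply/set0Pn; exists x; exact: setU11.
    rewrite /P !subUset !sub1set aE1F bE2F (subset_trans (subsetDl _ _) MF) /=.
    rewrite !card_setU1_disjoint // !trivIset_setU1 // => /(_ isT).
    by rewrite [#|M|](cardsD1 A) AM add1n ltnn.
  have /card_gt2P[x [y [z [[xA yA zA] [xy yz zx]]]]] : 2 < #|A| by rewrite F3.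
  have EA : A = x |: (y |: [set z]).
    apply/esym/eqP; rewrite eqEcard !subUset !sub1set xA yA zA F3 //=.
    by rewrite cardsU1 cards2 yz !inE negb_or xy eq_sym zx.
  rewrite (eq_bigr (fun a => #|G a|)) => [|a _]; last exact: GE.
  rewrite EA big_setU1 /=; last by rewrite !inE negb_or xy eq_sym zx.
  rewrite big_setU1 ?inE //= big_set1 addnA.
  have GA H : H \in [:: G x; G y; G z] -> exists2 a, a \in A & H = G a.
    by rewrite !inE => /or3P[]/eqP->; [exists x|exists y|exists z].
  apply: cross_triple => //.
  - by move=> H /GA[a _ ->].
  - by move=> H /GA[a _ ->].
  - by move=> H /GA[a aA ->]; exact: Gq.
  - exact: Gx.
  - by apply: Gx; rewrite // eq_sym.
  - exact: Gx.
have := card_le_maximal_matching F3 MF tM Mmeet Fh Mc.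
have MD : #|M| <= D := sunflower_free_trivIset FD MF tM.
(* Positivity makes [.-1] a true subtraction, so that the term [#|M|] on the left can be absorbed
   before [#|M|] is replaced by [D]. *)
have c0 : 0 < c by rewrite /c; lia.
nia.
Qed.

End Families.

(** * The diagonal value of [CH] and the final bound *)

(** For pairs, excluding sunflowers with [k.+1] petals amounts to bounding degrees and matchings by
    [k]; each inequality feeds an extremal object of one side to the other. *)
Lemma CH_diag_f2 k : (0 < k)%N -> CH k k = f 2 k.+1.
Proof.
move=> k0; apply/eqP; rewrite eqn_leq; apply/andP; split.
  have [[T [e [ge ek qk <-]]] _] := CH_maximum k k.
  have [_] := @f_maximum 2 k.+1 isT; apply.
  exists T, (edges e); split=> //; first exact: edges_uniform.
  apply: sunflower_free_graph => //; first exact: edges_uniform.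
    move=> x; apply: leq_trans ek; apply: leq_trans (leq_bigmax x).
    apply: leq_trans (leq_imset_card (fun y => [set x; y]) _).
    apply/subset_leq_card/subsetP=> A; rewrite inE => /andP[].
    case/imsetP=> [[y z]] /=; rewrite inE /= => eyz ->.
    rewrite !inE => /orP[]/eqP->; apply/imsetP.
      by exists z; rewrite ?inE.
    by exists y; rewrite ?inE ?(ge.1 z) // setUC.
  move=> S SE tS; apply: leq_trans qk.
  by apply: (leq_bigmax_cond (P := matching e)); rewrite /matching SE tS.
have [[T [F [F2 Fk <-]]] _] := @f_maximum 2 k.+1 isT.
apply: edges_card_le_CH => // [x|S]; first exact: sunflower_free_degree.
exact: sunflower_free_trivIset.
Qed.

Theorem theorem4p2 (k : nat) (hk : (4 <= k)%N) :
  let h := CH (k - 1) (k - 1) in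
  let c := maxn (CH (k - 1) (k - 2)) (3 * (k - 1)) in
  h = f 2 k /\
  (f 3 k)%:R <= (k%:R - 1) / 2 * (c%:R + 3 * h%:R - 1) :> rat.
Proof.
case: k hk => // D D3; rewrite subSS subn0 subSS subn1 => h c.
split; first by apply: CH_diag_f2; lia.
have [[T [F [F3 FD <-]]] _] := @f_maximum 3 D.+1 isT.
have := card_le_3uniform D3 F3 FD; rewrite -/c -/h.
(* Needed to cast the natural-number predecessor to a subtraction in [rat]. *)
have c0 : (0 < c + 3 * h)%N by rewrite /c; lia.
rewrite -(Num.Theory.ler_nat rat) !GRing.natrM -subn1 GRing.natrB //.
rewrite GRing.natrD GRing.natrM -[D.+1%:R]GRing.natr1.
lra.
Qed.
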